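(* Let $n\ge1$. (i) The representations $\rho_{G/P_n}$ and $\rho_{\tilde G/\tilde P_n}$ each decompose as a direct sum of $n+1$ irreducible components: one of degree $2^i$ for each $i\in\{1,\dots,n-1\}$ and two of degree $1$. (ii) The representations $\rho_{\Gamma/P_n}$, $\rho_{\overline\Gamma/P_n}$ and $\rho_{\overline{\overline\Gamma}/P_n}$ each decompose as a direct sum of $2n+1$ irreducible components: two of degree $3^i$ for each $i\in\{1,\dots,n-1\}$ and three of degree $1$.
   Context: The rooted trees are $\mathcal T_d=\{0,\dots,d-1\}^*$ for $d=2,3$; automorphisms act on the left on finite words. For a letter $x$ let $\overline x=x+1\bmod d$ and $\overline{\overline x}=x+2\bmod d$; $a$ is the automorphism $a(x\sigma)=\overline x\sigma$. All other generators below fix the first level pointwise and are defined recursively. $G=\langle a,b,c,d\rangle<\operatorname{Aut}(\mathcal T_2)$: $b(0x\sigma)=0\overline x\sigma$, $b(1\sigma)=1c(\sigma)$; $c(0x\sigma)=0\overline x\sigma$, $c(1\sigma)=1d(\sigma)$; $d(0x\sigma)=0x\sigma$, $d(1\sigma)=1b(\sigma)$. $\tilde G=\langle a,\tilde b,\tilde c,\tilde d\rangle<\operatorname{Aut}(\mathcal T_2)$: $\tilde b(0x\sigma)=0\overline x\sigma$, $\tilde b(1\sigma)=1\tilde c(\sigma)$; $\tilde c(0\sigma)=0\sigma$, $\tilde c(1\sigma)=1\tilde d(\sigma)$; $\tilde d(0\sigma)=0\sigma$, $\tilde d(1\sigma)=1\tilde b(\sigma)$. $\Gamma$, $\overline\Gamma$,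 $\overline{\overline\Gamma}$ are the subgroups $\langle a,t\rangle$ of $\operatorname{Aut}(\mathcal T_3)$ where $t(0x\sigma)=0\overline x\sigma$, $t(2\sigma)=2t(\sigma)$ and respectively $t(1x\sigma)=1x\sigma$ (for $\Gamma$), $t(1x\sigma)=1\overline x\sigma$ (for $\overline\Gamma$), $t(1x\sigma)=1\overline{\overline x}\sigma$ (for $\overline{\overline\Gamma}$). For $G$ and $\tilde G$, $P_n$ and $\tilde P_n$ denote the stabilizer of the vertex $1^n=1\cdots1$ of length $n$ (the level-$n$ vertex of the ray $1^\infty$); for $\Gamma,\overline\Gamma,\overline{\overline\Gamma}$, $P_n$ denotes the stabilizer of the vertex $2^n$ of length $n$. For a group $H$ and a subgroup $Q$, $\rho_{H/Q}$ is the quasi-regular (permutation) representation of $H$ on the complex space $\ell^2(H/Q)$. *)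

(* Defs.v *)
From HB Require Import structures.
From mathcomp Require Import all_boot all_order all_algebra.
From mathcomp Require Import complex.
From mathcomp Require Import all_classical all_reals ereal esum.
Set Implicit Arguments.
Unset Strict Implicit.
Unset Printing Implicit Defensive.

Import Order.TTheory GRing.Theory Num.Theory.
Local Open Scope classical_set_scope.
Local Open Scope group_scope.

(* An automorphism of the rooted tree of finite words over 'I_d is a bijection
   preserving the relation "v is a descendant of u", i.e. prefix u v. *)
Record treeAut (d : nat) := TreeAut {
  aut_fun :> seq 'I_d -> seq 'I_d;
  aut_bij : bijective aut_fun;
  aut_prefix : {mono aut_fun : u v / prefix u v} }.

HB.instance Definition _ d := gen_eqMixin (treeAut d).
HB.instance Definition _ d := gen_choiceMixin (treeAut d).

Section TreeAutGroup.
Variable d : nat.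
Implicit Types f g h : treeAut d.

Lemma treeAut_eq f g : f =1 g -> f = g.
Proof.
case: f g => [f fB fP] [g gB gP] /= /funext fg; move: fB fP; rewrite fg.
by move=> fB fP; congr TreeAut; exact: Prop_irrelevance.
Qed.

Definition aut1 : treeAut d :=
  @TreeAut d id (inv_bij (fun=> erefl)) (fun _ _ => erefl).

Definition autM f g : treeAut d :=
  @TreeAut d (f \o g) (bij_comp (aut_bij f) (aut_bij g))
    (fun u v => etrans (aut_prefix f _ _) (aut_prefix g u v)).

Lemma aut_inv_ex f :
  exists g : seq 'I_d -> seq 'I_d, cancel f g /\ cancel g f.
Proof. by case: (aut_bij f) => g fK gK; exists g. Qed.

Definition aut_inv_fun f := sval (cid (aut_inv_ex f)).

Lemma aut_funK f : cancel f (aut_inv_fun f).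
Proof. by rewrite /aut_inv_fun; case: cid => g []. Qed.

Lemma aut_inv_funK f : cancel (aut_inv_fun f) f.
Proof. by rewrite /aut_inv_fun; case: cid => g []. Qed.

Lemma aut_inv_prefix f : {mono aut_inv_fun f : u v / prefix u v}.
Proof. by move=> u v; rewrite -(aut_prefix f) !aut_inv_funK. Qed.

Definition autV f : treeAut d :=
  @TreeAut d (aut_inv_fun f) (Bijective (aut_inv_funK f) (aut_funK f))
    (@aut_inv_prefix f).

Lemma autMA : associative autM.
Proof. by move=> f g h; exact: treeAut_eq. Qed.

Lemma aut1M : left_id aut1 autM.
Proof. by move=> f; exact: treeAut_eq. Qed.

Lemma autM1 : right_id aut1 autM.
Proof. by move=> f; exact: treeAut_eq. Qed.

Lemma autVM : left_inverse aut1 autV autM.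
Proof. by move=> f; apply: treeAut_eq => w; exact: aut_funK. Qed.

Lemma autMV : right_inverse aut1 autV autM.
Proof. by move=> f; apply: treeAut_eq => w; exact: aut_inv_funK. Qed.

(* Tree automorphisms act on the left: (f * g) w = f (g w). *)
HB.instance Definition _ :=
  isGroup.Build (treeAut d) autMA aut1M autM1 autVM autMV.

End TreeAutGroup.

Section GeneratedSubgroup.
Variable gT : groupType.

Definition generated (S : set gT) : set gT :=
  smallest (fun H : set gT => group_closed (mem H)) S.

Lemma generated_closed (S : set gT) : group_closed (mem (generated S)).
Proof.
split=> [|x y].
  by rewrite inE => H [[H1 _] _]; rewrite inE in H1.
rewrite !inE => xS yS H HS; case: (HS) => -[_ HV] _.
by have := HV x y; rewrite !inE; apply; [exact: xS|exact: yS].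
Qed.

Definition generated_group (S : set gT) := set_type (generated S).

HB.instance Definition _ (S : set gT) := SubChoice.on (generated_group S).
HB.instance Definition _ (S : set gT) :=
  SubChoice_isSubGroup.Build gT _ (generated_group S) (generated_closed S).

End GeneratedSubgroup.

Section MapHead.
Variable d : nat.

Definition map_head (s : 'I_d -> 'I_d) (w : seq 'I_d) : seq 'I_d :=
  if w is x :: u then s x :: u else [::].

Lemma map_head_bij s : bijective s -> bijective (map_head s).
Proof.
case=> s' sK s'K; exists (map_head s') => -[|x u] //=.
  by rewrite sK.
by rewrite s'K.
Qed.

Lemma map_head_prefix s :
  bijective s -> {mono map_head s : u v / prefix u v}.
Proof. by move=> /bij_inj sI [|x u] [|y v] //=; rewrite (inj_eq sI). Qed.

Definition rot_aut : treeAut d :=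
  TreeAut (map_head_bij (@ordS_bij d)) (map_head_prefix (@ordS_bij d)).

End MapHead.

Fixpoint b_fun (w : seq 'I_2) : seq 'I_2 :=
  if w is x :: u then
    if x == 0%R then x :: map_head (@ordS 2) u else x :: c_fun u
  else [::]
with c_fun (w : seq 'I_2) : seq 'I_2 :=
  if w is x :: u then
    if x == 0%R then x :: map_head (@ordS 2) u else x :: d_fun u
  else [::]
with d_fun (w : seq 'I_2) : seq 'I_2 :=
  if w is x :: u then
    if x == 0%R then x :: u else x :: b_fun u
  else [::].

Fixpoint bt_fun (w : seq 'I_2) : seq 'I_2 :=
  if w is x :: u then
    if x == 0%R then x :: map_head (@ordS 2) u else x :: ct_fun u
  else [::]
with ct_fun (w : seq 'I_2) : seq 'I_2 :=
  if w is x :: u then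
    if x == 0%R then x :: u else x :: dt_fun u
  else [::]
with dt_fun (w : seq 'I_2) : seq 'I_2 :=
  if w is x :: u then
    if x == 0%R then x :: u else x :: bt_fun u
  else [::].

(* s is the identity, x |-> x + 1 or x |-> x + 2 (mod 3) for Gamma, Gamma_bar
   and Gamma_barbar respectively: t(1xu) = 1 s(x) u. *)
Fixpoint t_fun (s : 'I_3 -> 'I_3) (w : seq 'I_3) : seq 'I_3 :=
  if w is x :: u then
    if x == 0%R then x :: map_head (@ordS 3) u
    else if x == 1%R then x :: map_head s u
    else x :: t_fun s u
  else [::].

Lemma ordS2K : involutive (@ordS 2).
Proof. by move=> [[|[|]] // ?]; apply: val_inj. Qed.

Lemma map_head2K : involutive (map_head (@ordS 2)).
Proof. by case=> [|x u] //=; rewrite ordS2K. Qed.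

Lemma bcd_funK w : [/\ b_fun (b_fun w) = w, c_fun (c_fun w) = w
                     & d_fun (d_fun w) = w].
Proof.
elim: w => //= x u [IHb IHc IHd].
by case: ifP => /= x0; rewrite x0 ?map_head2K ?IHb ?IHc ?IHd.
Qed.

Lemma bcdt_funK w : [/\ bt_fun (bt_fun w) = w, ct_fun (ct_fun w) = w
                      & dt_fun (dt_fun w) = w].
Proof.
elim: w => //= x u [IHb IHc IHd].
by case: ifP => /= x0; rewrite x0 ?map_head2K ?IHb ?IHc ?IHd.
Qed.

Lemma bcd_fun_prefix u v : [/\ prefix (b_fun u) (b_fun v) = prefix u v,
  prefix (c_fun u) (c_fun v) = prefix u v
  & prefix (d_fun u) (d_fun v) = prefix u v].
Proof.
elim: u v => [|x u IH] [|y v] /=.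
- by [].
- by split; case: ifP.
- by split; case: ifP.
have [IHb IHc IHd] := IH v.
have hp := map_head_prefix (@ordS_bij 2).
have [<-|xy] := eqVneq x y.
  by case: ifP => /= _; rewrite !eqxx ?hp ?IHb ?IHc ?IHd.
by case: ifP; case: ifP => /= _ _; rewrite (negPf xy).
Qed.

Lemma bcdt_fun_prefix u v : [/\ prefix (bt_fun u) (bt_fun v) = prefix u v,
  prefix (ct_fun u) (ct_fun v) = prefix u v
  & prefix (dt_fun u) (dt_fun v) = prefix u v].
Proof.
elim: u v => [|x u IH] [|y v] /=.
- by [].
- by split; case: ifP.
- by split; case: ifP.
have [IHb IHc IHd] := IH v.
have hp := map_head_prefix (@ordS_bij 2).
have [<-|xy] := eqVneq x y.
  by case: ifP => /= _; rewrite !eqxx ?hp ?IHb ?IHc ?IHd.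
by case: ifP; case: ifP => /= _ _; rewrite (negPf xy).
Qed.

Lemma t_fun_bij s : bijective s -> bijective (t_fun s).
Proof.
move=> /map_head_bij [h' hK h'K].
have [k' kK k'K] := map_head_bij (@ordS_bij 3).
exists (fix t' (w : seq 'I_3) := if w is x :: u then
    if x == 0%R then x :: k' u else if x == 1%R then x :: h' u else x :: t' u
  else [::]); elim=> //= x u IH; (case: ifP => /= x0; first by rewrite x0 ?kK ?k'K);
  by case: ifP => /= x1; rewrite x0 x1 ?hK ?h'K ?IH.
Qed.

Lemma t_fun_prefix s : bijective s -> {mono t_fun s : u v / prefix u v}.
Proof.
move=> sB; have hp := map_head_prefix sB.
have kp := map_head_prefix (@ordS_bij 3).
elim=> [|x u IH] [|y v] /=.
- by [].
- by case: ifP => // _; case: ifP.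
- by case: ifP => // _; case: ifP.
have [<-|xy] := eqVneq x y.
  by case: ifP => [_|_]; last case: ifP => _; rewrite /= ?eqxx ?hp ?kp ?IH.
have xyF X Y : prefix (x :: X) (y :: Y) = false by rewrite /= (negPf xy).
by repeat (case: ifP => _); rewrite ?xyF.
Qed.

Definition gen_a2 : treeAut 2 := rot_aut 2.

Definition gen_b : treeAut 2 := TreeAut
  (inv_bij (fun w => let: And3 H _ _ := bcd_funK w in H))
  (fun u v => let: And3 H _ _ := bcd_fun_prefix u v in H).
Definition gen_c : treeAut 2 := TreeAut
  (inv_bij (fun w => let: And3 _ H _ := bcd_funK w in H))
  (fun u v => let: And3 _ H _ := bcd_fun_prefix u v in H).
Definition gen_d : treeAut 2 := TreeAut
  (inv_bij (fun w => let: And3 _ _ H := bcd_funK w in H))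
  (fun u v => let: And3 _ _ H := bcd_fun_prefix u v in H).

Definition tgen_b : treeAut 2 := TreeAut
  (inv_bij (fun w => let: And3 H _ _ := bcdt_funK w in H))
  (fun u v => let: And3 H _ _ := bcdt_fun_prefix u v in H).
Definition tgen_c : treeAut 2 := TreeAut
  (inv_bij (fun w => let: And3 _ H _ := bcdt_funK w in H))
  (fun u v => let: And3 _ H _ := bcdt_fun_prefix u v in H).
Definition tgen_d : treeAut 2 := TreeAut
  (inv_bij (fun w => let: And3 _ _ H := bcdt_funK w in H))
  (fun u v => let: And3 _ _ H := bcdt_fun_prefix u v in H).

Definition gen_a3 : treeAut 3 := rot_aut 3.

Definition t_aut s (sB : bijective s) : treeAut 3 :=
  TreeAut (t_fun_bij sB) (t_fun_prefix sB).

Definition gen_t : treeAut 3 := t_aut (inv_bij (fun=> erefl) : bijective id).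
Definition gen_t_bar : treeAut 3 := t_aut (@ordS_bij 3).
Definition gen_t_barbar : treeAut 3 :=
  t_aut (bij_comp (@ordS_bij 3) (@ordS_bij 3)).

Definition G := generated_group [set gen_a2; gen_b; gen_c; gen_d].
Definition G_tilde := generated_group [set gen_a2; tgen_b; tgen_c; tgen_d].
Definition Gamma := generated_group [set gen_a3; gen_t].
Definition Gamma_bar := generated_group [set gen_a3; gen_t_bar].
Definition Gamma_barbar := generated_group [set gen_a3; gen_t_barbar].

Definition vertex_stab d (S : set (treeAut d)) (w : seq 'I_d) :
    set (generated_group S) :=
  [set g : generated_group S | (val g : treeAut d) w = w].

Definition P_G (n : nat) : set G := vertex_stab (nseq n (1%R : 'I_2)).
Definition P_G_tilde (n : nat) : set G_tilde :=
  vertex_stab (nseq n (1%R : 'I_2)).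
Definition P_Gamma (n : nat) : set Gamma := vertex_stab (nseq n (2%R : 'I_3)).
Definition P_Gamma_bar (n : nat) : set Gamma_bar :=
  vertex_stab (nseq n (2%R : 'I_3)).
Definition P_Gamma_barbar (n : nat) : set Gamma_barbar :=
  vertex_stab (nseq n (2%R : 'I_3)).

Section CosetSpace.
Variables (H : groupType) (Q : set H).

Definition left_coset (h : H) : set H := [set h * q | q in Q].

Definition coset_space : set (set H) := range left_coset.

Lemma coset_act_subproof (g : H) (C : coset_space) :
  ([set g * x | x in val C] : set H) \in coset_space.
Proof.
case: C => C /=; rewrite !inE => -[h _ <-]; exists (g * h) => //.
by rewrite /left_coset image_comp; apply: eq_imagel => q _ /=; rewrite mulgA.
Qed.

Definition coset_act (g : H) (C : coset_space) : coset_space :=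
  SigSub (coset_act_subproof g C).

End CosetSpace.

Section Representations.
Local Open Scope ring_scope.
Variables (K : fieldType) (V : lmodType K) (H : groupType).
Variable rho : H -> V -> V.

Definition is_subspace (W : set V) : Prop :=
  W 0 /\ forall (k : K) u v, W u -> W v -> W (k *: u + v).

Definition is_subrep (W : set V) : Prop :=
  is_subspace W /\ forall g v, W v -> W (rho g v).

(* For a component of finite degree every subspace is closed, so no topological
   condition on U is needed. *)
Definition irreducible_subrep (W : set V) : Prop :=
  [/\ is_subrep W, W != [set 0]
    & forall U, is_subrep U -> U `<=` W -> U = [set 0] \/ U = W].

Definition has_degree (W : set V) (m : nat) : Prop :=
  exists2 e : 'I_m -> V, (forall i, W (e i)) &
    forall v, W v -> exists! k : 'I_m -> K, v = \sum_i k i *: e i.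

Definition is_direct_sum (E : set V) (m : nat) (W : 'I_m -> set V) : Prop :=
  (forall j, W j `<=` E) /\
  forall v, E v ->
    exists! w : 'I_m -> V, (forall j, W j (w j)) /\ v = \sum_j w j.

Definition decomposes (E : set V) (m : nat) (degs : seq nat) : Prop :=
  exists (W : 'I_m -> set V) (deg : 'I_m -> nat),
    [/\ is_direct_sum E W,
        forall j, irreducible_subrep (W j) /\ has_degree (W j) (deg j)
      & perm_eq [seq deg j | j : 'I_m] degs].

End Representations.

Section QuasiRegular.
Local Open Scope ring_scope.
Variables (R : realType) (H : groupType) (Q : set H).

Definition ell2 : set (coset_space Q -> R[i]) :=
  [set f | (\esum_(x in [set: coset_space Q])
              ((complex.Re (f x)) ^+ 2 + (complex.Im (f x)) ^+ 2)%:E < +oo)%E].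

Definition quasi_regular (g : H) (f : coset_space Q -> R[i]) :
  coset_space Q -> R[i] := fun x => f (coset_act (g^-1)%g x).

Lemma coset_act1 (x : coset_space Q) : coset_act 1%g x = x.
Proof.
by apply: val_inj => /=; rewrite (eq_imagel (fun y _ => mul1g y)) image_id.
Qed.

Lemma coset_actM (g h : H) (x : coset_space Q) :
  coset_act (g * h)%g x = coset_act g (coset_act h x).
Proof.
apply: val_inj => /=; rewrite image_comp.
by apply: eq_imagel => y _ /=; rewrite mulgA.
Qed.

Lemma quasi_regular1 f : quasi_regular 1%g f = f.
Proof. by apply/funext => x; rewrite /quasi_regular invg1 coset_act1. Qed.

Lemma quasi_regularM (g h : H) f :
  quasi_regular (g * h)%g f = quasi_regular g (quasi_regular h f).
Proof. by apply/funext => x; rewrite /quasi_regular invgM coset_actM. Qed.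

Lemma quasi_regular_linear (g : H) (k : R[i]) f1 f2 :
  quasi_regular g (k *: f1 + f2) =
  k *: quasi_regular g f1 + quasi_regular g f2.
Proof. by []. Qed.

End QuasiRegular.

Arguments ell2 R {H} Q.
Arguments quasi_regular {R H} Q g f.

(* Main.v *)
Require Import Defs.
From HB Require Import structures.
From mathcomp Require Import all_boot all_order all_algebra.
From mathcomp Require Import complex.
From mathcomp Require Import all_classical all_reals ereal esum.
From mathcomp Require Import ring.

(** By transitivity on levels, the cosets of [P_n] are the words of length
    [n], and the quasi-regular representation is the permutation
    representation on functions of such words. Let [d] be the size of the
    alphabet and [zeta] a primitive [d]-th root of unity. Every element of the
    five groups permutes the children of each vertex by a power of the
    rotation, so for [i < n] and [j < d] the functions of the form
    [h (x_0 ... x_(i-1)) * zeta ^ (j * x_i)], with [x_k] the letters of the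
    word, are a subrepresentation, [piece i j], of degree [d ^ i]. Fourier
    expansion in the last letter, repeated from the bottom of the tree to the
    top, shows that the constants [piece 0 0] and the [piece i j] with [j]
    nonzero span everything ([sum_pieces]), and distinct pieces are orthogonal
    because the rotation of one letter acts on them by different characters
    ([piece_dot]). The degrees are thus [d] times [1] and, for [0 < i < n],
    [d - 1] times [d ^ i].

    Irreducibility ([piece_irreducible]) is a spherical function argument. Let
    [p ^ i] be the vertex of level [i] of the distinguished ray. A nonzero
    subrepresentation contains a function that does not vanish at [p ^ n];
    averaging it over the stabilizer of [p ^ i.+1], up to normalization, gives
    an invariant function that still does not vanish there. For each vertex [u] of level [i] other than [p ^ i]
    the stabilizer contains an element that fixes [u] and rotates its children
    ([ray_stab_rotates]), so an invariant function in [piece i j] vanishes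
    below [u]. What remains is a multiple of one basis vector, and
    transitivity produces the others.

    The elements rotating below [u] come from the self-similarity of the
    groups. Up to moving along the ray, [u] starts with a letter [y] distinct
    from [p], and it is enough that the sections at [y] of the stabilizer of
    the ray act transitively on words. This follows once finitely many
    explicit elements of that stabilizer have prescribed sections at [y] or at
    [yp] ([sibling_sections]), which is checked for each of the five groups. *)

Set Implicit Arguments.
Unset Strict Implicit.
Unset Printing Implicit Defensive.
Import Order.TTheory GRing.Theory Num.Theory.
Local Open Scope classical_set_scope.
Local Open Scope group_scope.

(** * Generated subgroups and tree automorphisms *)

Section Generated.
Variables (gT : groupType) (S : set gT).

Lemma generated_sub : S `<=` generated S.
Proof. exact: sub_smallest. Qed.

Lemma generated1 : generated S 1.
Proof. by have [] := generated_closed S; rewrite inE. Qed.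

Lemma generatedV g : generated S g -> generated S g^-1.
Proof.
by have /group_closedV := generated_closed S => /(_ g); rewrite !inE; apply.
Qed.

Lemma generatedM g h : generated S g -> generated S h -> generated S (g * h).
Proof.
by have /group_closedM := generated_closed S => /(_ g h); rewrite !inE; apply.
Qed.

Lemma generated_ind (P : gT -> Prop) :
    (forall s, S s -> P s) -> P 1 ->
    (forall g h, P g -> P h -> P (g * h)) -> (forall g, P g -> P g^-1) ->
  forall g, generated S g -> P g.
Proof.
move=> PS P1 PM PV g; apply: (@smallest_sub _ _ _ [set x | P x]) => //.
split=> [|x y]; rewrite !inE //= => Px Py; exact/PM/PV.
Qed.

End Generated.

Section TreeAut.
Variable d : nat.
Implicit Types (g h : treeAut d) (w : seq 'I_d).

Lemma autME g h w : (g * h) w = g (h w). Proof. by []. Qed.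

Lemma autKV g w : g^-1 (g w) = w. Proof. exact: aut_funK. Qed.

Lemma autVK g w : g (g^-1 w) = w. Proof. exact: aut_inv_funK. Qed.

(** A strict prefix stays strict, so [g] cannot shorten a word; neither can its
    inverse. *)
Lemma size_aut g w : size (g w) = size w.
Proof.
have leq_size h u : (size u <= size (h u))%N.
  elim/last_ind: u => [|u x IHu] //; rewrite size_rcons.
  apply: leq_ltn_trans IHu _.
  have := prefix_rcons u x; rewrite -(aut_prefix h) => /prefixP[v hv].
  rewrite hv size_cat -{1}[size _]addn0 ltn_add2l lt0n size_eq0.
  apply/eqP => v0; move: hv; rewrite v0 cats0 => /(bij_inj (aut_bij h)).
  by move=> /(congr1 size)/eqP; rewrite size_rcons gtn_eqF.
by apply/eqP; rewrite eqn_leq leq_size -{2}(autKV g w) leq_size.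
Qed.

Lemma take_aut g i w : take i (g w) = g (take i w).
Proof.
have := prefix_take w i; rewrite -(aut_prefix g) prefixE => /eqP <-.
rewrite size_aut size_take_min take_min -[w in size w](autKV g) size_aut.
by rewrite take_size.
Qed.

End TreeAut.

(** * Sections along a ray and level transitivity *)

Section Criterion.
Variables (q : nat) (S : set (treeAut q.+2)) (p : 'I_q.+2).
Implicit Types (g h : treeAut q.+2) (x y : 'I_q.+2) (u v w : seq 'I_q.+2).

(** The portrait of [f] takes its values in the cyclic group generated by the
    rotation of the alphabet. *)
Definition rotary (f : seq 'I_q.+2 -> seq 'I_q.+2) :=
  forall w, exists k : 'I_q.+2, forall x, f (rcons w x) = rcons (f w) (x + k)%R.

Lemma rotary1 : rotary (1 : treeAut q.+2).
Proof. by move=> w; exists 0%R => x; rewrite addr0. Qed.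

Lemma rotaryM g h : rotary g -> rotary h -> rotary (g * h).
Proof.
move=> rg rh w; have [k hk] := rh w; have [l gl] := rg (h w).
by exists (k + l)%R => x; rewrite !autME hk gl addrA.
Qed.

Lemma rotaryV g : rotary g -> rotary g^-1%g.
Proof.
move=> rg w; have [k gk] := rg (g^-1 w); exists (- k)%R => x.
rewrite -[RHS](autKV g) gk autVK; congr (_ (rcons _ _)).
by rewrite addrNK.
Qed.

Lemma rotary_generated :
  (forall s, S s -> rotary s) -> forall g, generated S g -> rotary g.
Proof.
move=> rS; apply: generated_ind => //.
- exact: rotary1.
- exact: rotaryM.
- exact: rotaryV.
Qed.

Definition ray_stab : set (treeAut q.+2) :=
  [set g | generated S g /\ forall k, g (nseq k p) = nseq k p].

Lemma ray_stabM g h : ray_stab g -> ray_stab h -> ray_stab (g * h).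
Proof.
move=> [Sg pg] [Sh ph]; split; first exact: generatedM.
by move=> k; rewrite autME ph pg.
Qed.

Lemma ray_stabV g : ray_stab g -> ray_stab g^-1.
Proof.
move=> [Sg pg]; split; first exact: generatedV.
by move=> k; rewrite -{1}pg autKV.
Qed.

Lemma ray_stab1 : ray_stab 1.
Proof. by split; first exact: generated1. Qed.

Definition has_section (K : set (treeAut q.+2)) v h :=
  exists2 g, K g & forall w, g (v ++ w) = v ++ h w.

Lemma ray_section v g h :
    generated S g -> (forall k, g (nseq k p) = nseq k p) ->
    (forall w, g (v ++ w) = v ++ h w) ->
  has_section ray_stab v h.
Proof. by exists g. Qed.

Section SubgroupSections.
Variable K : set (treeAut q.+2).
Hypotheses (K1 : K 1) (KM : forall g h, K g -> K h -> K (g * h)).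
Hypothesis KV : forall g, K g -> K g^-1.

Lemma has_sectionM v g h :
  has_section K v g -> has_section K v h -> has_section K v (g * h).
Proof.
move=> [g' Kg vg] [h' Kh vh]; exists (g' * h'); first exact: KM.
by move=> w; rewrite !autME vh vg.
Qed.

Lemma has_sectionV v g : has_section K v g -> has_section K v g^-1.
Proof.
move=> [g' Kg vg]; exists g'^-1; first exact: KV.
by move=> w; rewrite -{1}[w](autVK g) -vg autKV.
Qed.

Lemma has_section1 v : has_section K v 1.
Proof. by exists 1. Qed.

Lemma has_section_generated v :
    (forall s, S s -> has_section K v s) ->
  forall g, generated S g -> has_section K v g.
Proof.
move=> KS; apply: generated_ind => //.
- exact: has_section1.
- exact: has_sectionM.
- exact: has_sectionV.
Qed.

Lemma has_sectionX v g k : has_section K v g -> has_section K v (g ^+ k).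
Proof.
move=> vg; elim: k => [|k IHk]; first by rewrite expg0; exact: has_section1.
by rewrite expgS; exact: has_sectionM.
Qed.

End SubgroupSections.

Let has_section_genE v := @has_section_generated (generated S)
  (@generated1 _ S) (@generatedM _ S) (@generatedV _ S) v.

Let has_section_rayE v := @has_section_generated ray_stab
  ray_stab1 ray_stabM ray_stabV v.

Lemma ordSE x : ordS x = (x + 1)%R.
Proof. by apply: val_inj; rewrite /= addn1. Qed.

Lemma rot_autX k x w : (rot_aut q.+2 ^+ k) (x :: w) = (x + k%:R)%R :: w.
Proof.
elim: k => [|k IHk]; first by rewrite expg0 addr0.
by rewrite expgS autME IHk /= ordSE -addrA -natr1.
Qed.

Lemma rot_autX_sub x y w : (rot_aut q.+2 ^+ (y - x)%R) (x :: w) = y :: w.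
Proof. by rewrite rot_autX natr_Zp subrKC. Qed.

Definition self_replicating := S (rot_aut q.+2) /\
  forall s, S s -> has_section (generated S) [:: p] s.

(** What makes the stabilizer of the ray act transitively on the words below
    each sibling [y] of [p]. Its group of sections at [y] may be a proper
    subgroup, so all generators are only required one level further down, next
    to a rotation at [y] itself. *)
Definition sibling_sections := forall y, y != p ->
  has_section ray_stab [:: y] (rot_aut q.+2) /\
  forall s, S s -> has_section ray_stab [:: y; p] s.

Definition ray_criterion :=
  [/\ forall s, S s -> rotary s, self_replicating & sibling_sections].

Section LevelTransitive.
Hypothesis sr : self_replicating.

(** Move [p] to the first letter of [u] by a power of the rotation; below [p]
    every element of the group occurs as a section, so induction applies. *)
Lemma level_transitive u :
  exists2 g, generated S g & g (nseq (size u) p) = u.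
Proof.
have [Sa lift] := sr; elim: u => [|x u [g Sg gu]].
  by exists 1; first exact: generated1.
have [h Sh hg] := has_section_genE lift Sg.
have [r Sr ar] : has_section (generated S) [::] (rot_aut q.+2 ^+ (x - p)%R).
  apply: has_sectionX; [exact: generated1|exact: generatedM|].
  by exists (rot_aut q.+2) => //; exact: generated_sub.
exists (r * h); first exact: generatedM.
by rewrite autME (hg (nseq (size u) p)) /= gu ar rot_autX_sub.
Qed.

(** The easy case, in which the sections at [y] already exhaust the group. *)
Lemma sibling_sections_full y :
  (forall s, S s -> has_section ray_stab [:: y] s) ->
  has_section ray_stab [:: y] (rot_aut q.+2) /\
  forall s, S s -> has_section ray_stab [:: y; p] s.
Proof.
have [Sa lift] := sr => yS; split=> [|s Ss]; first exact: yS.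
have [g Sg gs] := lift _ Ss.
have [h Rh hg] := has_section_rayE yS Sg.
by exists h => // w; rewrite -cat1s -catA hg /= (gs w).
Qed.

Hypothesis sib : sibling_sections.

(** A rotation at [y] brings the first letter to [p], and the sections at [yp]
    form the whole, level transitive, group. *)
Lemma sibling_transitive y u v : y != p -> size u = size v ->
  exists2 g, ray_stab g & g (y :: u) = y :: v.
Proof.
move=> /sib[yrot yS].
have main w : exists2 g, ray_stab g & g (y :: nseq (size w) p) = y :: w.
  case: w => [|x w]; first by exists 1; first exact: ray_stab1.
  have [h Sh hw] := level_transitive w.
  have [g Rg gh] := has_section_rayE yS Sh.
  have [r Rr ra] := @has_sectionX _ ray_stab1 ray_stabM _ _ (x - p)%R yrot.
  exists (r * g); first exact: ray_stabM.
  rewrite autME /= (gh (nseq (size w) p)) hw.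
  by rewrite (ra (p :: w)) rot_autX_sub.
have [g Rg gu] := main u; have [h Rh hv] := main v => suv.
exists (h * g^-1); first by apply: ray_stabM => //; exact: ray_stabV.
by rewrite autME -gu autKV suv hv.
Qed.

(** A vertex [u] off the ray leaves it through some letter distinct from [p].
    Below the branching point [sibling_transitive] moves one child of [u] to
    the other, and self-replication carries the element up along the ray. This
    is what kills the coefficient at [u] of an averaged function in
    [average_basis]. *)
Lemma ray_stab_rotates u : u != nseq (size u) p ->
  exists2 g, ray_stab g & g (rcons u 0%R) = rcons u 1%R.
Proof.
elim: u => [|x u IHu] //=; rewrite eqseq_cons.
have [-> /= /IHu [h [Sh ph] hu]|xp _] := eqVneq x p; last first.
  by apply: sibling_transitive => //; rewrite !size_rcons.
have [g Sg gh] := has_section_genE sr.2 Sh.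
exists g; last by rewrite (gh (rcons u _)) hu.
split=> // -[|k]; last by rewrite /= (gh (nseq k p)) ph.
by apply: size0nil; rewrite size_aut.
Qed.

End LevelTransitive.

End Criterion.

(** * The five groups *)

Lemma rotary_map_head q (s : 'I_q.+2 -> 'I_q.+2) (k : 'I_q.+2) :
  (forall x, s x = x + k)%R -> rotary (map_head s).
Proof.
move=> sk [|y w]; first by exists k => x; rewrite /= sk.
by exists 0%R => x; rewrite addr0.
Qed.

Lemma rotary_rot q : rotary (rot_aut q.+2).
Proof. exact: (rotary_map_head (@ordSE q)). Qed.

Lemma aut_nil d (g : treeAut d) : g [::] = [::].
Proof. by apply: size0nil; rewrite size_aut. Qed.

Lemma ord2P (y : 'I_2) : y = 0%R \/ y = 1%R.
Proof. by case: y => [[|[|]] // ?]; [left|right]; exact: val_inj. Qed.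

Lemma ord3P (y : 'I_3) : [\/ y = 0%R, y = 1%R | y = 2%R].
Proof.
by case: y => [[|[|[|]]] // ?];
  [apply: Or31|apply: Or32|apply: Or33]; exact: val_inj.
Qed.

Lemma nseqS (T : Type) k (x : T) : nseq k.+1 x = x :: nseq k x.
Proof. by []. Qed.

Lemma nseq0 (T : Type) (x : T) : nseq 0 x = [::].
Proof. by []. Qed.

Lemma ord2_rotE w :
  (rot_aut 2 (0%R :: w) = 1%R :: w) * (rot_aut 2 (1%R :: w) = 0%R :: w).
Proof. by split; congr cons; apply: val_inj. Qed.

Ltac in_generated := repeat (apply: generatedM || apply: generatedV);
  apply: generated_sub => /=; tauto.

Ltac fixes_ray E :=
  move=> [|[|k]]; rewrite ?nseqS ?nseq0 ?autME; by rewrite !(E, aut_nil).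

Ltac computes_section E :=
  move=> w; rewrite ?cat_cons ?cat0s ?autME; by rewrite ?E.

(** One recursion covers both groups: [e] is the rotation for [G] and the
    identity for [G_tilde]. Below, [(g0, g1)] denotes the element fixing the
    first level with sections [g0] and [g1]; thus [b = (a, c)], [c = (e, d)] and
    [d = (1, b)]. *)
Section Grigorchuk.
Variables a b c d e : treeAut 2.
Hypothesis aR : a = rot_aut 2.
Hypothesis bE : forall w,
  (b (0%R :: w) = 0%R :: a w) * (b (1%R :: w) = 1%R :: c w).
Hypothesis cE : forall w,
  (c (0%R :: w) = 0%R :: e w) * (c (1%R :: w) = 1%R :: d w).
Hypothesis eK : forall w, e (e w) = w.
Hypothesis eR : rotary e.
Hypothesis dE : forall w,
  (d (0%R :: w) = 0%R :: w) * (d (1%R :: w) = 1%R :: b w).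
Local Notation S := [set a; b; c; d].
Local Notation ray k := (nseq k (1%R : 'I_2)).

Let aE w : (a (0%R :: w) = 1%R :: w) * (a (1%R :: w) = 0%R :: w).
Proof. by rewrite aR !ord2_rotE. Qed.

Let aK w : a (a w) = w.
Proof.
by case: w => [|x w]; rewrite ?aut_nil //; case: (ord2P x) => ->; rewrite !aE.
Qed.

Let bcdK w : (b (b w) = w) * (c (c w) = w) * (d (d w) = w).
Proof.
elim: w => [|x w IHw]; first by rewrite !aut_nil.
by case: (ord2P x) => ->; rewrite !(bE, cE, dE, aK, eK, IHw).
Qed.

Let bcd_ray k : (b (ray k) = ray k) * (c (ray k) = ray k) * (d (ray k) = ray k).
Proof.
elim: k => [|k IHk]; first by rewrite nseq0 !aut_nil.
by rewrite nseqS !(bE, cE, dE, IHk).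
Qed.

Let E := (aE, bE, cE, dE, aK, bcdK, bcd_ray).

Lemma rotary_Grigorchuk s : S s -> rotary s.
Proof.
move=> Ss w; move: s Ss; suff H : [/\
      exists k, forall x, b (rcons w x) = rcons (b w) (x + k)%R,
      exists k, forall x, c (rcons w x) = rcons (c w) (x + k)%R
    & exists k, forall x, d (rcons w x) = rcons (d w) (x + k)%R].
  by move=> s [[[->|->]|->]|->]; [rewrite aR; exact: rotary_rot|case: H..].
elim: w => [|y w [[k bk] [l cl] [m dm]]].
  by split; exists 0%R => x; rewrite !aut_nil addr0 -!cats1 !cat0s;
    case: (ord2P x) => ->; rewrite E ?aut_nil.
case: (ord2P y) => ->; last first.
  by split; [exists l|exists m|exists k] => x; rewrite rcons_cons !E ?cl ?dm ?bk.
have [n an] := rotary_rot w; rewrite -aR in an; have [l' el] := eR w.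
by split; [exists n|exists l'|exists 0%R] => x;
  rewrite rcons_cons !E ?an ?el ?addr0.
Qed.

Lemma self_replicating_Grigorchuk : self_replicating S 1%R.
Proof.
split=> [|s]; first by rewrite /= aR; tauto.
case=> [[[->|->]|->]|->].
- by exists (a * b * a); [in_generated|computes_section E].
- by exists d; [in_generated|computes_section E].
- by exists b; [in_generated|computes_section E].
- by exists c; [in_generated|computes_section E].
Qed.

Lemma sibling_sections_G : (forall w, e w = a w) -> sibling_sections S 1%R.
Proof.
move=> ea.
have d_bc w : d w = b (c w).
  suff H : [/\ d w = b (c w), b w = c (d w) & c w = d (b w)] by case: H.
  elim: w => [|x w [IHd IHb IHc]]; first by rewrite !aut_nil.
  by case: (ord2P x) => ->; rewrite !(bE, cE, dE) ?ea ?aK -?IHd -?IHb -?IHc.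
move=> y y1; have {y y1}-> : y = 0%R.
  by case: (ord2P y) => // yE; rewrite yE eqxx in y1.
rewrite -aR; split.
  by apply: (ray_section (g := b));
    [in_generated|fixes_ray (E, ea)|computes_section (E, ea)].
pose f := a * c * a.
(* f = (d, a), so f c f c = (dada, adad), and dada = adad = (b, b). *)
have sb : has_section (ray_stab S 1%R) [:: 0%R; 1%R] b.
  apply: (ray_section (g := f * c * f * c)); rewrite /f;
    [in_generated|fixes_ray (E, ea)|computes_section (E, ea)].
(* a d a = (b, 1) and b has section c at 1. *)
have sc : has_section (ray_stab S 1%R) [:: 0%R; 1%R] c.
  by apply: (ray_section (g := a * d * a));
    [in_generated|fixes_ray (E, ea)|computes_section (E, ea)].
move=> s [[[->|->]|->]|->] //.
  (* b (a d a) b = (a b a, 1), and a b a = (c, a). *)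
  by apply: (ray_section (g := b * a * d * a * b));
    [in_generated|fixes_ray (E, ea)|computes_section (E, ea)].
have d_eq : d = b * c by apply: treeAut_eq => w; rewrite d_bc.
by rewrite [X in has_section _ _ X]d_eq;
  exact: (has_sectionM (@ray_stabM _ _ _) sb sc).
Qed.

Lemma sibling_sections_G_tilde : (forall w, e w = w) -> sibling_sections S 1%R.
Proof.
move=> e1 y y1; have {y y1}-> : y = 0%R.
  by case: (ord2P y) => // yE; rewrite yE eqxx in y1.
rewrite -aR; split.
  by apply: (ray_section (g := b));
    [in_generated|fixes_ray (E, e1)|computes_section (E, e1)].
move=> s [[[->|->]|->]|->].
(* b (a d a) b = (a b a, 1), and a b a = (c, a). *)
- by apply: (ray_section (g := b * a * d * a * b));
    [in_generated|fixes_ray (E, e1)|computes_section (E, e1)].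
(* a c a = (d, 1) and a d a = (b, 1). *)
- by apply: (ray_section (g := a * c * a));
    [in_generated|fixes_ray (E, e1)|computes_section (E, e1)].
- by apply: (ray_section (g := a * d * a));
    [in_generated|fixes_ray (E, e1)|computes_section (E, e1)].
(* (a b)^4 = (caca, acac), and caca = acac = (d, d). *)
apply: (ray_section (g := a * b * a * b * a * b * a * b));
  [in_generated|fixes_ray (E, e1)|computes_section (E, e1)].
Qed.

End Grigorchuk.

Lemma ord3_rotE w :
  (rot_aut 3 (0%R :: w) = 1%R :: w) * (rot_aut 3 (1%R :: w) = 2%R :: w) *
  (rot_aut 3 (2%R :: w) = 0%R :: w).
Proof. by do !split; congr cons; apply: val_inj. Qed.

(** With [(g0, g1, g2)] for the element fixing the first level with these
    sections, [t = (a, s, t)], where [s] is the identity, [a] or [a * a] for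
    [Gamma], [Gamma_bar] and [Gamma_barbar]. Its conjugates by powers of [a] are
    [t1 = (t, a, s)] and [t2 = (s, t, a)]. *)
Section Ternary.
Variables a t s : treeAut 3.
Hypothesis aR : a = rot_aut 3.
Hypothesis sR : rotary s.
Hypothesis tE : forall w, (t (0%R :: w) = 0%R :: a w) *
  (t (1%R :: w) = 1%R :: s w) * (t (2%R :: w) = 2%R :: t w).
Local Notation S := [set a; t].
Local Notation ray k := (nseq k (2%R : 'I_3)).

Let aE w : (a (0%R :: w) = 1%R :: w) * (a (1%R :: w) = 2%R :: w) *
  (a (2%R :: w) = 0%R :: w).
Proof. by rewrite aR !ord3_rotE. Qed.

Let aVE w : (a^-1 (0%R :: w) = 2%R :: w) * (a^-1 (1%R :: w) = 0%R :: w) *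
  (a^-1 (2%R :: w) = 1%R :: w).
Proof. by do !split; apply: (canLR (autKV a)); rewrite aE. Qed.

Let tVE w : (t^-1 (0%R :: w) = 0%R :: a^-1 w) *
  (t^-1 (1%R :: w) = 1%R :: s^-1 w) * (t^-1 (2%R :: w) = 2%R :: t^-1 w).
Proof. by do !split; apply: (canLR (autKV t)); rewrite tE autVK. Qed.

Let t_ray k : (t (ray k) = ray k) * (t^-1 (ray k) = ray k).
Proof.
elim: k => [|k IHk]; first by rewrite nseq0 !aut_nil.
by rewrite nseqS !(tE, tVE, IHk).
Qed.

Let KE (g : treeAut 3) w : (g (g^-1 w) = w) * (g^-1 (g w) = w).
Proof. by rewrite autVK autKV. Qed.

Let E := (aE, aVE, tE, tVE, KE, t_ray).

Lemma rotary_ternary g : S g -> rotary g.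
Proof.
case=> ->; first by rewrite aR; exact: rotary_rot.
elim=> [|y w [k tk]].
  exists 0%R => x; rewrite !aut_nil addr0 -!cats1 !cat0s.
  by case: (ord3P x) => ->; rewrite E aut_nil.
have [l al] := rotary_rot w; rewrite -aR in al; have [m sm] := sR w.
by case: (ord3P y) => ->; [exists l|exists m|exists k] => x;
  rewrite rcons_cons !E ?al ?sm ?tk.
Qed.

Lemma self_replicating_ternary : self_replicating S 2%R.
Proof.
split=> [|g]; first by rewrite /= aR; tauto.
case=> ->.
- by exists (a^-1 * t * a); [in_generated|computes_section E].
- by exists t; [in_generated|computes_section E].
Qed.

Let t1 := a * t * a^-1.
Let t2 := a^-1 * t * a.

(** Here [t] and [t1] fix the ray and have sections [a] and [t] at [0]. The
    sections at [1], by contrast, do not contain [t], which explains the two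
    levels in [sibling_sections]. *)
Lemma sibling_sections_Gamma : (forall w, s w = w) -> sibling_sections S 2%R.
Proof.
move=> s1 y y2; have sV w : s^-1 w = w by rewrite -{1}[w]s1 autKV.
have {y2}[-> | ->] : y = 0%R \/ y = 1%R.
  by case: (ord3P y) y2 => ->; rewrite ?eqxx; auto.
  apply: sibling_sections_full; first exact: self_replicating_ternary.
  move=> g [->|->].
    by apply: (ray_section (g := t));
      [in_generated|fixes_ray E|computes_section E].
  by apply: (ray_section (g := t1)); rewrite /t1;
    [in_generated|fixes_ray (E, s1)|computes_section E].
rewrite -aR; split.
  by apply: (ray_section (g := t1)); rewrite /t1;
    [in_generated|fixes_ray (E, s1)|computes_section E].
move=> g [->|->].
  (* This is t1 e^-1 t1^-1, where e = (1, t a t^-1 a^-1, 1) is the witness for t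
     below; its section at 1 is a (t a t^-1 a^-1)^-1 a^-1. *)
  apply: (ray_section (g := t1 * (t1 * t2 * t1^-1 * t2^-1) * t1^-1));
    rewrite /t1 /t2 ?invgM ?invgK;
    [in_generated|fixes_ray (E, s1, sV)|computes_section (E, s1, sV)].
(* The commutator of t2 and t1 is (1, t a t^-1 a^-1, 1), and
   t a t^-1 a^-1 = (a t^-1, a^-1, t). *)
apply: (ray_section (g := t2 * t1 * t2^-1 * t1^-1));
    rewrite /t1 /t2 ?invgM ?invgK;
    [in_generated|fixes_ray (E, s1, sV)|computes_section (E, s1, sV)].
Qed.

Lemma sibling_sections_Gamma_bar :
  (forall w, s w = a w) -> sibling_sections S 2%R.
Proof.
move=> sa y y2; have sV w : s^-1 w = a^-1 w.
  by apply: (canLR (autKV s)); rewrite sa autVK.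
apply: sibling_sections_full; first exact: self_replicating_ternary.
move=> g gS; have {y2}[-> | ->] : y = 0%R \/ y = 1%R.
- by case: (ord3P y) y2 => ->; rewrite ?eqxx; auto.
- case: gS => ->.
    by apply: (ray_section (g := t));
      [in_generated|fixes_ray E|computes_section E].
  (* t1 t2^-1 = (t a^-1, a t^-1, 1). *)
  apply: (ray_section (g := t1 * t2^-1 * t)); rewrite /t1 /t2 ?invgM ?invgK;
    [in_generated|fixes_ray (E, sa, sV)|computes_section (E, sa, sV)].
case: gS => ->.
  by apply: (ray_section (g := t));
    [in_generated|fixes_ray E|computes_section (E, sa)].
apply: (ray_section (g := t2 * t1^-1 * t)); rewrite /t1 /t2 ?invgM ?invgK;
    [in_generated|fixes_ray (E, sa, sV)|computes_section (E, sa, sV)].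
Qed.

Lemma sibling_sections_Gamma_barbar :
  (forall w, s w = a (a w)) -> sibling_sections S 2%R.
Proof.
move=> sa y y2.
have aaa w : a (a (a w)) = w.
  by case: w => [|x w]; rewrite ?aut_nil //; case: (ord3P x) => ->; rewrite !E.
have sV w : s^-1 w = a w by apply: (canLR (autKV s)); rewrite sa aaa.
apply: sibling_sections_full; first exact: self_replicating_ternary.
move=> g gS; have {y2}[-> | ->] : y = 0%R \/ y = 1%R.
- by case: (ord3P y) y2 => ->; rewrite ?eqxx; auto.
- case: gS => ->.
    by apply: (ray_section (g := t));
      [in_generated|fixes_ray E|computes_section E].
  (* t1 t2 = (t a^2, a t, a^3). *)
  apply: (ray_section (g := t1 * t2 * t)); rewrite /t1 /t2;
    [in_generated|fixes_ray (E, sa, aaa)|computes_section (E, sa, aaa)].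
case: gS => ->.
  (* t t = (a^2, a^4, t^2). *)
  by apply: (ray_section (g := t * t));
    [in_generated|fixes_ray E|computes_section (E, sa, aaa)].
apply: (ray_section (g := t2 * t1 * t)); rewrite /t1 /t2;
    [in_generated|fixes_ray (E, sa, aaa)|computes_section (E, sa, aaa)].
Qed.

End Ternary.

Lemma ray_criterion_G : ray_criterion [set gen_a2; gen_b; gen_c; gen_d] 1%R.
Proof.
have aK w : gen_a2 (gen_a2 w) = w := map_head2K w.
split.
- exact: (@rotary_Grigorchuk _ _ _ _ gen_a2 _ _ _ (@rotary_rot _)).
- exact: (self_replicating_Grigorchuk (e := gen_a2)).
- exact: (sibling_sections_G (e := gen_a2)).
Qed.

Lemma ray_criterion_G_tilde :
  ray_criterion [set gen_a2; tgen_b; tgen_c; tgen_d] 1%R.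
Proof.
split.
- exact: (@rotary_Grigorchuk _ _ _ _ 1 _ _ _ (@rotary1 _)).
- exact: (self_replicating_Grigorchuk (e := 1)).
- exact: (sibling_sections_G_tilde (e := 1)).
Qed.

Lemma ray_criterion_Gamma : ray_criterion [set gen_a3; gen_t] 2%R.
Proof.
have tE w : (gen_t (0%R :: w) = 0%R :: gen_a3 w) *
    (gen_t (1%R :: w) = 1%R :: (1 : treeAut 3) w) *
    (gen_t (2%R :: w) = 2%R :: gen_t w).
  by split=> //; case: w.
split.
- exact: (rotary_ternary _ (@rotary1 _) tE).
- exact: (self_replicating_ternary _ tE).
- exact: (sibling_sections_Gamma _ tE).
Qed.

Lemma ray_criterion_Gamma_bar : ray_criterion [set gen_a3; gen_t_bar] 2%R.
Proof.
have tE w : (gen_t_bar (0%R :: w) = 0%R :: gen_a3 w) *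
    (gen_t_bar (1%R :: w) = 1%R :: gen_a3 w) *
    (gen_t_bar (2%R :: w) = 2%R :: gen_t_bar w) by [].
split.
- exact: (rotary_ternary _ (@rotary_rot _) tE).
- exact: (self_replicating_ternary _ tE).
- exact: (sibling_sections_Gamma_bar _ tE).
Qed.

Lemma ray_criterion_Gamma_barbar : ray_criterion [set gen_a3; gen_t_barbar] 2%R.
Proof.
have tE w : (gen_t_barbar (0%R :: w) = 0%R :: gen_a3 w) *
    (gen_t_barbar (1%R :: w) = 1%R :: (gen_a3 * gen_a3) w) *
    (gen_t_barbar (2%R :: w) = 2%R :: gen_t_barbar w).
  by split=> //; case: w.
split.
- exact: (rotary_ternary _ (rotaryM (@rotary_rot _) (@rotary_rot _)) tE).
- exact: (self_replicating_ternary _ tE).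
- exact: (sibling_sections_Gamma_barbar _ tE).
Qed.

Local Close Scope group_scope.
Local Open Scope ring_scope.

(** * The representation on functions of the words of length n *)

Section Linear.
Variables (K : fieldType) (V : lmodType K) (W : set V).
Hypothesis sW : is_subspace W.

Lemma subspaceZ k v : W v -> W (k *: v).
Proof.
by have [W0 WL] := sW => Wv; have := WL k v 0 Wv W0; rewrite addr0.
Qed.

Lemma subspaceD u v : W u -> W v -> W (u + v).
Proof.
by have [W0 WL] := sW => Wu Wv; have := WL 1 u v Wu Wv; rewrite scale1r.
Qed.

Lemma subspaceB u v : W u -> W v -> W (u - v).
Proof.
by move=> Wu Wv; rewrite -scaleN1r; apply: subspaceD => //; exact: subspaceZ.
Qed.

Lemma subspace_sum (I : finType) (P : pred I) (F : I -> V) :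
  (forall i, P i -> W (F i)) -> W (\sum_(i | P i) F i).
Proof.
by move=> WF; elim/big_ind: _ => //; [exact: sW.1|exact: subspaceD].
Qed.

Lemma has_degree_card (I : finType) (e : I -> V) :
    (forall i, W (e i)) ->
    (forall v, W v -> exists! k : I -> K, v = \sum_i k i *: e i) ->
  has_degree W #|I|.
Proof.
move=> We eB; exists (e \o enum_val) => [i|v Wv]; first exact: We.
have sumE (k : I -> K) :
    \sum_i k i *: e i = \sum_(i < #|I|) k (enum_val i) *: e (enum_val i).
  by rewrite big_enum_val.
have [k [-> kU]] := eB v Wv; exists (k \o enum_val); split=> [|l lE].
  exact: sumE.
have kl : k = l \o enum_rank.
  apply: kU; rewrite lE sumE; apply: eq_bigr => i _ /=.
  by rewrite enum_valK.
by apply/funext => i /=; rewrite kl /= enum_valK.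
Qed.

End Linear.

Section LevelAction.
Variables (d n : nat).
Implicit Types (g h : treeAut d) (x : n.-tuple 'I_d).

Lemma level_act_subproof g x : size (g x) == n.
Proof. by rewrite size_aut size_tuple. Qed.

Definition level_act g x : n.-tuple 'I_d := Tuple (level_act_subproof g x).

Lemma level_actM g h x : level_act (g * h)%g x = level_act g (level_act h x).
Proof. exact: val_inj. Qed.

Lemma level_actVK g : cancel (level_act g^-1%g) (level_act g).
Proof. by move=> x; apply: val_inj; exact: autVK. Qed.

Lemma take_level_act g i x : take i (level_act g x) = g (take i x).
Proof. exact: take_aut. Qed.

End LevelAction.

Section Words.
Variables (R : realType) (q n : nat) (S : set (treeAut q.+2)).
Local Notation C := R[i].
Local Notation "z ^*" := (Num.conj z).
Variables (p : 'I_q.+2) (zeta : C).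
Hypothesis zetaP : q.+2.-primitive_root zeta.
Hypothesis rS : forall s, S s -> rotary s.
Hypothesis sr : self_replicating S p.
Hypothesis sib : sibling_sections S p.
Local Notation X := (n.-tuple 'I_q.+2).
Local Notation H := (generated_group S).
Local Notation letter x i := (nth (0 : 'I_q.+2) x i).
Implicit Types (u w : seq 'I_q.+2) (x y : X) (i j k : nat) (v : X -> C).

Definition level_rep (g : H) v : X -> C :=
  fun x => v (level_act (val g)^-1%g x).

Lemma valH (g : H) : generated S (val g).
Proof. by have := valP g; rewrite inE. Qed.

Lemma letter_act (g : treeAut q.+2) i w : rotary g -> exists k : 'I_q.+2,
  forall x, (i < n)%N -> take i x = w ->
  letter (level_act g x) i = letter x i + k.
Proof.
move=> /(_ w)[k gk]; exists k => x lt_in xw.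
have lt_ix : (i < size x)%N by rewrite size_tuple.
have sw : size w = i by rewrite -xw size_takel // ltnW.
have := take_aut g i.+1 x; rewrite (take_nth 0 lt_ix) xw gk.
by rewrite (take_nth 0) ?size_aut // => /rcons_inj[].
Qed.

(** ** Characters of the cyclic group of rotations *)

Definition chi j (a : 'I_q.+2) : C := zeta ^+ (j * a).

Lemma chiD j (a b : 'I_q.+2) : chi j (a + b) = chi j a * chi j b.
Proof.
rewrite /chi -exprD -mulnDr /= -[LHS](prim_expr_mod zetaP) modnMmr.
by rewrite (prim_expr_mod zetaP).
Qed.

Lemma chi0r j : chi j 0 = 1. Proof. by rewrite /chi muln0. Qed.

Lemma chi0l a : chi 0 a = 1. Proof. by rewrite /chi mul0n. Qed.

Lemma chi_neq0 j a : chi j a != 0.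
Proof.
rewrite expf_neq0 //; apply: contra_eq_neq (prim_expr_order zetaP) => ->.
by rewrite expr0n eq_sym oner_eq0.
Qed.

Lemma chi1_inj j k : (j < q.+2)%N -> (k < q.+2)%N -> chi j 1 = chi k 1 -> j = k.
Proof.
move=> jq kq /eqP; rewrite /chi !muln1 (eq_prim_root_expr zetaP).
by rewrite !modn_small // => /eqP.
Qed.

Lemma sum_chi (a : 'I_q.+2) :
  \sum_(j < q.+2) chi j a = if a == 0 then q.+2%:R else 0.
Proof.
case: eqVneq => [->|a0].
  by under eq_bigr do rewrite chi0r; rewrite sumr_const card_ord.
have z1 : zeta ^+ a - 1 != 0.
  rewrite subr_eq0 -(expr0 zeta) (eq_prim_root_expr zetaP) mod0n modn_small //.
apply: (mulfI z1); rewrite mulr0.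
under eq_bigr do rewrite /chi mulnC exprM.
by rewrite -subrX1 exprAC (prim_expr_order zetaP) expr1n subrr.
Qed.

Lemma norm_chi j a : `|chi j a| = 1.
Proof.
have : `|chi j a| ^+ q.+2 = 1.
  by rewrite -normrX /chi exprAC (prim_expr_order zetaP) expr1n normr1.
by move/eqP; rewrite pexpr_eq1 // => /eqP.
Qed.

(** ** The pieces *)

(** Functions of the first [i.+1] letters that transform by the [j]-th
    character under rotation of the last of them. The condition is written
    multiplicatively, without a representative function on words of length [i],
    so that linearity and invariance are immediate. *)
Definition piece i j : set (X -> C) :=
  [set v | forall x y, take i x = take i y ->
    v x * chi j (letter y i) = v y * chi j (letter x i)].

Lemma piece_subspace i j : is_subspace (piece i j).
Proof.
split=> [x y _|k v v' Wv Wv' x y xy]; first by rewrite !mul0r.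
by rewrite !fctE !mulrDl -!scalerAl (Wv _ _ xy) (Wv' _ _ xy).
Qed.

(** An element of a rotary group shifts the [i]-th letters of all words with a
    common prefix of length [i] by the same amount, which only contributes a
    common nonzero factor. *)
Lemma piece_subrep i j : (i < n)%N -> is_subrep level_rep (piece i j).
Proof.
move=> lt_in; split=> [|g v Wv x y xy]; first exact: piece_subspace.
have gV := generatedV (valH g).
have [k gk] := letter_act i (take i x) (rotary_generated rS gV).
have := Wv (level_act (val g)^-1%g x) (level_act (val g)^-1%g y).
rewrite !take_level_act xy !gk // !chiD !mulrA => /(_ erefl).
by move/mulIf; apply; exact: chi_neq0.
Qed.

Lemma pad_subproof w : size (mkseq (nth 0 w) n) == n.
Proof. by rewrite size_mkseq. Qed.

Definition pad w : X := Tuple (pad_subproof w).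

Lemma take_pad i w : (i < n)%N -> size w = i -> take i (pad w) = w.
Proof.
move=> lt_in sw; have st : size (take i (pad w)) = size w.
  by rewrite size_takel // size_tuple ltnW.
apply: (eq_from_nth (x0 := 0)) => // k; rewrite st sw => lt_ki.
by rewrite nth_take // nth_mkseq // (ltn_trans lt_ki).
Qed.

Lemma letter_pad i w : (i < n)%N -> size w = i -> letter (pad w) i = 0.
Proof. by move=> lt_in sw; rewrite nth_mkseq // nth_default // sw. Qed.

(** For [w] of length [i]: the basis vector of [piece i j] supported below
    [w]. *)
Definition piece_basis i j w : X -> C :=
  fun x => if take i x == w then chi j (letter x i) else 0.

Lemma piece_basisW i j w : piece i j (piece_basis i j w).
Proof.
move=> x y xy; rewrite /piece_basis xy.
by case: eqP => _; rewrite ?mul0r // mulrC.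
Qed.

Lemma piece_expand i j v : (i < n)%N -> piece i j v ->
  v = \sum_(w : i.-tuple 'I_q.+2) v (pad w) *: piece_basis i j w.
Proof.
move=> lt_in Wv; apply/funext => x; rewrite fct_sumE.
have st : size (take i x) == i by rewrite size_takel // size_tuple ltnW.
rewrite (bigD1 (Tuple st)) //= big1 ?addr0 => [|w]; last first.
  rewrite -val_eqE /= eq_sym => /negPf wx.
  by rewrite !fctE /piece_basis wx scaler0.
rewrite !fctE /piece_basis eqxx.
have := Wv x (pad (take i x)).
rewrite letter_pad ?(eqP st) // take_pad ?(eqP st) //.
by rewrite chi0r mulr1 => /(_ erefl).
Qed.

Lemma piece_degree i j : (i < n)%N -> has_degree (piece i j) (q.+2 ^ i).
Proof.
move=> lt_in; have <- : #|{: i.-tuple 'I_q.+2}| = (q.+2 ^ i)%N.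
  by rewrite card_tuple card_ord.
apply: (has_degree_card (e := fun w : i.-tuple _ => piece_basis i j w)).
  by move=> w; exact: piece_basisW.
move=> v Wv; exists (v \o (fun w : i.-tuple _ => pad w)); split=> [|k vE].
  exact: piece_expand.
apply/funext => w /=; rewrite vE fct_sumE (bigD1 w) //= big1 ?addr0 => [|u].
  rewrite !fctE /piece_basis take_pad ?size_tuple // eqxx.
  by rewrite letter_pad ?size_tuple // chi0r [_ *: _]mulr1.
move=> /negPf uw; rewrite !fctE /piece_basis take_pad ?size_tuple //.
by rewrite eq_sym val_eqE uw scaler0.
Qed.

(** ** Substituting a letter *)

Definition subst_letter x i (a : 'I_q.+2) : X :=
  [tuple if k == i :> nat then a else letter x k | k < n].

Lemma letter_subst x i a k : (k < n)%N ->
  letter (subst_letter x i a) k = if k == i then a else letter x k.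
Proof.
move=> lt_kn; rewrite -(tnth_nth 0 _ (Ordinal lt_kn)) tnth_mktuple //.
Qed.

Lemma take_subst x i k a : (k <= i)%N ->
  take k (subst_letter x i a) = take k x.
Proof.
move=> le_ki; apply: (eq_from_nth (x0 := 0)) => [|l].
  by rewrite !size_take_min !size_tuple.
rewrite size_take_min size_tuple leq_min => /andP[lt_lk lt_ln].
rewrite !nth_take // letter_subst // ltn_eqF //; exact: leq_trans le_ki.
Qed.

Lemma subst_letter_id x i : subst_letter x i (letter x i) = x.
Proof.
apply/val_inj/(@eq_from_nth _ 0); first by rewrite !size_tuple.
by move=> k; rewrite size_tuple => lt_kn; rewrite letter_subst //;
  case: eqP => [->|].
Qed.

Lemma subst_subst x i a b :
  subst_letter (subst_letter x i a) i b = subst_letter x i b.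
Proof.
apply/val_inj/(@eq_from_nth _ 0); first by rewrite !size_tuple.
move=> k; rewrite size_tuple => lt_kn; rewrite !letter_subst //.
by case: eqP.
Qed.

Lemma piece_subst i j v x a : (i < n)%N -> piece i j v ->
  v (subst_letter x i a) * chi j (letter x i) = v x * chi j a.
Proof.
move=> lt_in /(_ (subst_letter x i a) x); rewrite take_subst // => ->//.
by rewrite letter_subst // eqxx.
Qed.

Lemma piece_subst_gt i j v x k a : (k < i)%N -> (i < n)%N -> piece k j v ->
  v (subst_letter x i a) = v x.
Proof.
move=> lt_ki lt_in /(_ (subst_letter x i a) x); rewrite take_subst 1?ltnW //.
rewrite letter_subst ?(ltn_trans lt_ki) // ltn_eqF // => /(_ erefl).
by move/mulIf; apply; exact: chi_neq0.
Qed.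

(** ** Orthogonality *)

Definition dot v v' : C := \sum_x v x * (v' x)^*.

Lemma dot_eq0 v : dot v v = 0 -> v = 0.
Proof.
move/psumr_eq0P => v0; apply/funext => x.
by apply/eqP; rewrite -normr_eq0 -sqrf_eq0 normCK v0 // => y _;
  rewrite mul_conjC_ge0.
Qed.

Lemma dot_suml (I : finType) (F : I -> X -> C) v :
  dot (\sum_i F i) v = \sum_i dot (F i) v.
Proof.
rewrite /dot exchange_big; apply: eq_bigr => x _.
by rewrite fct_sumE mulr_suml.
Qed.

Lemma dot_sym v v' : dot v v' = 0 -> dot v' v = 0.
Proof.
move=> vv'; apply: (inv_inj conjCK); rewrite conjC0 -vv' rmorph_sum.
by apply: eq_bigr => x _; rewrite rmorphM /= conjCK mulrC.
Qed.

(** Rotating the [i]-th letter is unitary and multiplies the two functions by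
    distinct scalars of modulus one. *)
Lemma piece_dot i j i' j' v v' : (i < n)%N -> (i' <= i)%N ->
    chi j 1 != (if i' == i then chi j' 1 else 1) ->
  piece i j v -> piece i' j' v' -> dot v v' = 0.
Proof.
move=> lt_in le_i'i; set mu := (if _ then _ else _) => neq Wv Wv'.
pose r x := subst_letter x i (letter x i + 1).
have rI : injective r.
  apply: (can_inj (g := fun x => subst_letter x i (letter x i - 1))) => x.
  by rewrite /r letter_subst // eqxx subst_subst addrK subst_letter_id.
have vr x : v (r x) = v x * chi j 1.
  have := piece_subst x (letter x i + 1) lt_in Wv.
  by rewrite chiD mulrCA [LHS]mulrC => /(mulfI (chi_neq0 _ _)).
have v'r x : v' (r x) = v' x * mu.
  rewrite /mu; case: eqP Wv' => [->|/eqP ne_i'i] Wv'.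
    have := piece_subst x (letter x i + 1) lt_in Wv'.
    by rewrite chiD mulrCA [LHS]mulrC => /(mulfI (chi_neq0 _ _)).
  by rewrite mulr1 (piece_subst_gt _ _ _ _ Wv') // ltn_neqAle ne_i'i.
have mu1 : mu * mu^* = 1.
  rewrite -normCK /mu; case: ifP => _; first by rewrite norm_chi expr1n.
  by rewrite normr1 expr1n.
have dE : dot v v' = dot v v' * (chi j 1 * mu^*).
  rewrite {1}/dot (reindex_inj rI) mulr_suml; apply: eq_bigr => x _.
  by rewrite vr v'r rmorphM /= mulrACA.
apply/eqP; have /eqP := dE; rewrite -{1}[dot v v']mulr1 -subr_eq0 -mulrBr mulf_eq0.
case/orP => //; rewrite subr_eq0 => /eqP c1; case/eqP: neq.
by rewrite -[LHS]mulr1 -mu1 mulrCA mulrA -mulrA -c1 mulr1.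
Qed.

(** ** Irreducibility *)

Lemma level_rep_basis i j g w : (i < n)%N -> exists2 c, c != 0 &
  level_rep g (piece_basis i j w) = c *: piece_basis i j (val g w).
Proof.
move=> lt_in; have gV := generatedV (valH g).
have [k gk] := letter_act i (val g w) (rotary_generated rS gV).
exists (chi j k); first exact: chi_neq0.
have eqV u : ((val g)^-1%g u == w) = (u == val g w).
  by apply/eqP/eqP => [<-|->]; rewrite ?autVK ?autKV.
apply/funext => x; rewrite /level_rep /piece_basis !fctE take_level_act eqV.
case: eqP => [xw|_]; last by rewrite scaler0.
by rewrite gk // chiD mulrC.
Qed.

(** By transitivity one basis vector generates all of them. *)
Lemma basis_subrep_full i j U : (i < n)%N -> is_subrep level_rep U ->
  U (piece_basis i j (nseq i p)) -> piece i j `<=` U.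
Proof.
move=> lt_in [sU gU] Up v Wv; rewrite (piece_expand lt_in Wv).
apply: subspace_sum => // w _; apply: subspaceZ => //.
have [g Sg gw] := level_transitive sr w; rewrite size_tuple in gw.
have Hg : g \in generated S by rewrite inE.
have [c c0] := level_rep_basis j (SigSub Hg : H) (nseq i p) lt_in.
rewrite /= gw => cE; have := gU (SigSub Hg : H) _ Up.
by rewrite cE => /(subspaceZ sU c^-1); rewrite scalerA mulVf // scale1r.
Qed.

Definition fixator i : set (treeAut q.+2) :=
  [set g | generated S g /\ g (nseq i p) = nseq i p].

(** The vertex stabilizer may be infinite; averaging uses the finite set of maps
    it induces on the words of length [n], without dividing by its cardinal. *)
Definition fixator_maps i : {pred {ffun X -> X}} :=
  [pred f : {ffun X -> X} |
    `[< exists2 g, fixator i g & forall x, f x = level_act g x >]].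

Lemma fixator_mapsP i (f : {ffun X -> X}) : reflect
  (exists2 g, fixator i g & forall x, f x = level_act g x) (f \in fixator_maps i).
Proof. exact: asboolP. Qed.

Definition average i v : X -> C := \sum_(f in fixator_maps i) (v \o f).

Lemma average_subrep i v U : is_subrep level_rep U -> U v -> U (average i v).
Proof.
move=> [sU gU] Uv; apply: subspace_sum => // f /fixator_mapsP[g [Sg _] fg].
have Hg : g^-1%g \in generated S by rewrite inE; exact: generatedV.
suff -> : v \o f = level_rep (SigSub Hg : H) v by exact: gU.
by apply/funext => x; rewrite /level_rep /= fg invgK.
Qed.

Lemma average_invariant i v g x : fixator i g ->
  average i v (level_act g x) = average i v x.
Proof.
move=> [Sg gp]; rewrite /average !fct_sumE /=.
pose h (f : {ffun X -> X}) := [ffun y => f (level_act g y)].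
have hI : injective h.
  move=> f f' /ffunP ff'; apply/ffunP => y; have := ff' (level_act g^-1%g y).
  by rewrite !ffunE level_actVK.
rewrite [RHS](reindex_inj hI) /=; apply: eq_big => [f|f _];
  last by rewrite ffunE.
apply/fixator_mapsP/fixator_mapsP => -[k [Sk kp] fk].
  exists (k * g)%g; first by split; [exact: generatedM|rewrite autME gp kp].
  by move=> y; rewrite ffunE fk level_actM.
exists (k * g^-1)%g.
  split; first by apply: generatedM => //; exact: generatedV.
  by rewrite autME -{1}gp autKV.
move=> y; rewrite level_actM -fk ffunE level_actVK //.
Qed.

(** Averaging over the stabilizer of the vertex [p ^ i.+1] leaves only the basis
    function at [p ^ i]: at any other vertex of level [i] some element of the
    stabilizer rotates the children, so the value of the average there equals
    itself times a nontrivial root of unity. For [i = 0] there is no other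
    vertex, and the trivial character is allowed. *)
Lemma average_basis i j v : (i < n)%N -> (j < q.+2)%N -> (0 < i -> 0 < j)%N ->
    piece i j v -> v (pad (nseq n p)) != 0 ->
  exists2 c, c != 0 & average i.+1 v = c *: piece_basis i j (nseq i p).
Proof.
move=> lt_in lt_jq j_gt0 Wv vp; set x0 := pad _ in vp.
have tk k : (k <= n)%N -> take k x0 = nseq k p.
  move=> le_kn; apply: (eq_from_nth (x0 := 0)) => [|l].
    by rewrite size_takel ?size_tuple // size_nseq.
  rewrite size_takel ?size_tuple // => lt_lk; have lt_ln := leq_trans lt_lk le_kn.
  by rewrite nth_take // nth_mkseq // !nth_nseq lt_lk lt_ln.
have lx0 : letter x0 i = p by rewrite nth_mkseq // nth_nseq lt_in.
have WA : piece i j (average i.+1 v) :=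
  average_subrep i.+1 (piece_subrep j lt_in) Wv.
have A0 : average i.+1 v x0 != 0.
  rewrite /average fct_sumE (eq_bigr (fun=> v x0)) => [|f]; last first.
    move=> /fixator_mapsP[g [Sg gp] fg] /=; rewrite fg.
    have tg : take i.+1 (level_act g x0) = take i.+1 x0.
      by rewrite take_level_act tk.
    have lg : letter (level_act g x0) i = letter x0 i.
      by rewrite -(nth_take _ (ltnSn i)) tg nth_take.
    have ti : take i (level_act g x0) = take i x0.
      by rewrite -(take_takel _ (leqnSn i)) tg take_takel.
    by have := Wv _ _ ti; rewrite lg => /(mulIf (chi_neq0 _ _)).
  rewrite sumr_const -mulr_natr mulf_neq0 // pnatr_eq0 -lt0n; apply/card_gt0P.
  exists [ffun x => x]; apply/fixator_mapsP; exists 1%g.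
    by split=> //; exact: generated1.
  by move=> x; rewrite ffunE; apply: val_inj.
exists (average i.+1 v x0 / chi j p);
  first by rewrite mulf_neq0 // invr_eq0 chi_neq0.
apply/funext => x; rewrite !fctE /piece_basis; case: eqP => [xp|xp].
  have := WA x x0; rewrite tk 1?ltnW // => /(_ xp); rewrite lx0 => AE.
  by apply: (mulIf (chi_neq0 j p));
    rewrite AE [_ *: _]/(_ * _) mulrAC divfK ?chi_neq0.
rewrite scaler0; set w := take i x in xp.
have sw : size w = i by rewrite size_takel // size_tuple ltnW.
have wp : w != nseq (size w) p by rewrite sw; apply/eqP.
have i_gt0 : (0 < i)%N.
  by case: {+}i sw xp => // /size0nil ->.
have [g [Sg pg] gw] := ray_stab_rotates sr sib wp.
have rg := rotary_generated rS Sg.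
have gw_w : g w = w.
  have := congr1 (take i) gw; rewrite take_aut.
  by rewrite -!cats1 !take_size_cat.
have g1 : letter (level_act g x) i = letter x i + 1.
  have [l gl] := letter_act i w rg.
  rewrite gl //; congr (_ + _); have [l' gl'] := rg w.
  have := gl' 0; rewrite gw gw_w add0r => /rcons_inj[->].
  have := gl x lt_in erefl.
  have lt_ix : (i < size x)%N by rewrite size_tuple.
  have := take_level_act g i.+1 x; rewrite (take_nth 0 lt_ix) gl'.
  rewrite (take_nth 0) ?size_tuple // => /rcons_inj[_ ->].
  by move/addrI.
have tg : take i (level_act g x) = take i x by rewrite take_level_act.
have := WA _ _ tg; rewrite g1 average_invariant ?chiD; last by split.
move/esym/eqP; rewrite mulrA -[in X in _ == X](mulr1 (_ * _)) -subr_eq0 -mulrBr.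
rewrite !mulf_eq0.
rewrite (negPf (chi_neq0 _ _)) orbF subr_eq0 => /orP[/eqP //|/eqP c1].
by have := j_gt0 i_gt0; rewrite (chi1_inj lt_jq _ (etrans c1 (esym (chi0l 1)))).
Qed.

(** By transitivity a nonzero subrepresentation contains a function that does
    not vanish at [p ^ n], hence its average, hence a basis vector, hence
    everything. *)
Lemma piece_irreducible i j : (i < n)%N -> (j < q.+2)%N -> (0 < i -> 0 < j)%N ->
  irreducible_subrep level_rep (piece i j).
Proof.
move=> lt_in lt_jq j_gt0; split; first exact: piece_subrep.
  apply/eqP => W0; have : [set 0] (piece_basis i j (nseq i p)).
    by rewrite -W0; exact: piece_basisW.
  move=> /(congr1 (@^~ (pad (nseq i p)))).
  rewrite /piece_basis take_pad ?size_nseq //.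
  by rewrite eqxx => /eqP; apply/negP; exact: chi_neq0.
move=> U sU UW; have [U0|] := pselect (forall v, U v -> v = 0).
  left; apply/seteqP; split=> [v /U0 //|v ->]; exact: sU.1.1.
move=> /existsNP[v /not_implyP[Uv v0]]; right; apply/seteqP; split=> //.
have [x vx] : exists x, v x != 0.
  apply: contrapT => /forallNP v00; apply: v0; apply/funext => x.
  by apply/eqP; apply: contrapT => /negP; exact: v00.
have [g Sg gx] := level_transitive sr x.
have Hg : g^-1%g \in generated S by rewrite inE; exact: generatedV.
pose v' := level_rep (SigSub Hg : H) v.
have Uv' : U v' by exact: sU.2.
have v'p : v' (pad (nseq n p)) != 0.
  rewrite /v' /level_rep /= invgK.
  suff -> : level_act g (pad (nseq n p)) = x by [].
  apply: val_inj => /=; rewrite -gx size_tuple; congr (g _).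
  apply: (eq_from_nth (x0 := 0)); rewrite size_mkseq ?size_nseq // => k lt_kn.
  by rewrite nth_mkseq.
have [c c0 cE] := average_basis lt_in lt_jq j_gt0 (UW _ Uv') v'p.
apply: basis_subrep_full => //.
have := average_subrep i.+1 sU Uv'; rewrite cE => /(subspaceZ sU.1 c^-1).
by rewrite scalerA mulVf // scale1r.
Qed.

(** ** The direct sum *)

(** The pieces of the decomposition, numbered from [0]: the constants
    [piece 0 0] first, then for each level [i] the [q.+1] pieces [piece i j]
    with [j] nonzero. *)
Definition lev k := (k.-1 %/ q.+1)%N.
Definition frq k := if k is l.+1 then (l %% q.+1).+1 else 0%N.

Lemma lev_lt k : (0 < n)%N -> (k < (q.+1 * n).+1)%N -> (lev k < n)%N.
Proof.
by case: k => [|k] n_gt0; rewrite /lev ?div0n //= ltnS ltn_divLR // mulnC.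
Qed.

Lemma frq_lt k : (frq k < q.+2)%N.
Proof. by case: k => // k; rewrite ltnS ltn_mod. Qed.

Lemma frq_gt0 k : (0 < lev k)%N -> (0 < frq k)%N.
Proof. by case: k => //; rewrite /lev div0n. Qed.

Lemma lev_frq_inj k l : lev k = lev l -> frq k = frq l -> k = l.
Proof.
case: k l => [|k] [|l] //=; rewrite /lev /= => kl [kl'].
by rewrite (divn_eq k q.+1) (divn_eq l q.+1) kl kl'.
Qed.

(** The component of frequency [j] of [v] as a function of the [i]-th letter
    alone. *)
Definition fourier i j v : X -> C := fun x => q.+2%:R^-1 *
  \sum_(a : 'I_q.+2) chi j (letter x i - a) * v (subst_letter x i a).

Lemma sum_fourier i v : (i < n)%N -> v = \sum_(j < q.+2) fourier i j v.
Proof.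
move=> lt_in; apply/funext => x.
rewrite fct_sumE /fourier -mulr_sumr exchange_big /=.
under eq_bigr do rewrite -mulr_suml sum_chi subr_eq0 eq_sym.
rewrite (bigD1 (letter x i)) //= eqxx big1 => [|a /negPf->];
  last by rewrite mul0r.
by rewrite addr0 subst_letter_id mulKf // pnatr_eq0.
Qed.

Definition depends i v := forall x y, take i x = take i y -> v x = v y.

Lemma take_substS x y i a : (i < n)%N -> take i x = take i y ->
  take i.+1 (subst_letter x i a) = take i.+1 (subst_letter y i a).
Proof.
move=> lt_in xy; rewrite !(take_nth 0) ?size_tuple //.
by rewrite !letter_subst // eqxx !take_subst // xy.
Qed.

Lemma fourier_piece i j v : (i < n)%N -> depends i.+1 v ->
  piece i j (fourier i j v).
Proof.
move=> lt_in dv x y xy; rewrite /fourier -!mulrA; congr (_ * _).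
rewrite !mulr_suml; apply: eq_bigr => a _.
rewrite (dv _ _ (take_substS a lt_in xy)) !chiD -!mulrA mulrCA [RHS]mulrCA.
congr (_ * _); rewrite mulrCA [chi j (letter y i) * _]mulrCA; congr (_ * _).
by rewrite mulrC.
Qed.

Lemma fourier0_depends i v : (i < n)%N -> depends i.+1 v ->
  depends i (fourier i 0 v).
Proof.
move=> lt_in dv x y xy; have := fourier_piece 0 lt_in dv xy.
by rewrite !chi0l !mulr1.
Qed.

(** Expand in the last relevant letter; the component of frequency [0] no longer
    depends on it and is treated by induction. *)
Lemma sum_pieces i v : (0 < n)%N -> (i <= n)%N -> depends i v ->
  exists w : nat -> X -> C, (forall k, (k < (q.+1 * i).+1)%N ->
    piece (lev k) (frq k) (w k)) /\ v = \sum_(k < (q.+1 * i).+1) w k.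
Proof.
move=> n_gt0; elim: i v => [|i IHi] v lt_in dv.
  exists (fun=> v); split=> [k|]; last by rewrite muln0 big_ord1.
  by rewrite muln0 ltnS leqn0 => /eqP-> x y _;
    rewrite !chi0l !mulr1 (dv x y) ?take0.
have [w [wW wE]] := IHi _ (ltnW lt_in) (fourier0_depends lt_in dv).
pose w' k := if (k < (q.+1 * i).+1)%N then w k else fourier i (frq k) v.
exists w'; split=> [k|].
  rewrite /w' mulnS => lt_ki; case: ltnP => [|]; first exact: wW.
  case: k lt_ki => // k lt_ki le_ik.
  have -> : lev k.+1 = i.
    rewrite /lev /=; apply/eqP; rewrite eqn_leq -ltnS ltn_divLR // leq_divRL //.
    by rewrite ![(_ * q.+1)%N]mulnC mulnS -ltnS lt_ki.
  exact: fourier_piece.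
rewrite [LHS](sum_fourier _ lt_in) big_ord_recl wE mulnS addnC -addSn big_split_ord /=.
congr (_ + _); apply: eq_bigr => k _; rewrite /w' /= ?ltn_ord //.
by rewrite ltnNge leq_addr /= [(q.+1 * i)%N]mulnC modnMDl modn_small.
Qed.

Theorem level_rep_decomposes : (0 < n)%N ->
  decomposes level_rep setT (q.+1 * n).+1
    (mkseq (fun k => q.+2 ^ lev k)%N (q.+1 * n).+1).
Proof.
move=> n_gt0; set m := (q.+1 * n).+1.
exists (fun k : 'I_m => piece (lev k) (frq k)), (fun k : 'I_m => q.+2 ^ lev k)%N.
split.
- split=> // v _.
  have dv : depends n v.
    by move=> x y; rewrite !take_oversize ?size_tuple // => /val_inj ->.
  have [w [wW wE]] := sum_pieces n_gt0 (leqnn n) dv.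
  exists (fun k : 'I_m => w k); split; first by split=> // k; exact: wW.
  move=> w' [w'W]; rewrite {}wE => wE; apply/funext => k; apply/eqP.
  rewrite -subr_eq0; apply/eqP/dot_eq0.
  have dW (l : 'I_m) : piece (lev l) (frq l) (w l - w' l).
    by apply: (subspaceB (piece_subspace _ _)) => //; exact: wW.
  have d0 (l : 'I_m) : l != k -> dot (w l - w' l) (w k - w' k) = 0.
    move=> lk.
    have orth (s s' : 'I_m) : s != s' -> (lev s' <= lev s)%N ->
        dot (w s - w' s) (w s' - w' s') = 0.
      move=> ss' le_s's; apply: (piece_dot _ _ _ (dW s) (dW s')) => //.
        exact: lev_lt.
      case: (lev s' =P lev s) => [ls|/eqP ls].
        apply: contra_neqN ss' => /eqP/(chi1_inj (frq_lt _) (frq_lt _)) fs.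
        exact/val_inj/lev_frq_inj.
      have /frq_gt0 : (0 < lev s)%N.
        by rewrite (leq_ltn_trans (leq0n (lev s'))) // ltn_neqAle ls.
      rewrite -(chi0l 1) lt0n; apply: contra_neqN => /eqP.
      exact: (chi1_inj (frq_lt _) (ltn0Sn _)).
    have [/orth->//|/ltnW le] := leqP (lev k) (lev l).
    by apply/dot_sym/orth => //; rewrite eq_sym.
  have : dot (\sum_(l < m) (w l - w' l)) (w k - w' k) = 0.
    by rewrite sumrB wE subrr /dot big1 // => x _; exact: mul0r.
  by rewrite dot_suml (bigD1 k) //= big1 ?addr0.
- move=> k; have ll := lev_lt n_gt0 (ltn_ord k); split; last exact: piece_degree.
  by apply: piece_irreducible => //; [exact: frq_lt|exact: frq_gt0].
by rewrite /mkseq -val_enum_ord -map_comp /=.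
Qed.

End Words.

(** * Transport to the quasi-regular representation *)

Section Transport.
Variables (K : fieldType) (V V' : lmodType K) (H : groupType).
Variables (rho : H -> V -> V) (rho' : H -> V' -> V').
Variables (M : {linear V -> V'}) (L : V' -> V).
Hypotheses (MK : cancel M L) (LK : cancel L M).
Hypothesis ME : forall g v, M (rho g v) = rho' g (M v).

Let L_lin k u v : L (k *: u + v) = k *: L u + L v.
Proof. by apply: (can_inj MK); rewrite linearP !LK. Qed.

Let L0 : L 0 = 0. Proof. by rewrite -(linear0 M) MK. Qed.

Let LE g v : L (rho' g v) = rho g (L v).
Proof. by apply: (can_inj MK); rewrite ME !LK. Qed.

Lemma preimage_subrep W : is_subrep rho' W -> is_subrep rho (M @^-1` W).
Proof.
move=> [[W0 WL] Wg]; split; first split.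
- by rewrite /= linear0.
- by move=> k u v Wu Wv; rewrite /= linearP; exact: WL.
- by move=> g v Wv; rewrite /= ME; exact: Wg.
Qed.

Lemma preimage_inv_subrep W : is_subrep rho W -> is_subrep rho' (L @^-1` W).
Proof.
move=> [[W0 WL] Wg]; split; first split.
- by rewrite /= L0.
- by move=> k u v Wu Wv; rewrite /= L_lin; exact: WL.
- by move=> g v Wv; rewrite /= LE; exact: Wg.
Qed.

Lemma preimage_irreducible W :
  irreducible_subrep rho' W -> irreducible_subrep rho (M @^-1` W).
Proof.
move=> [sW W0 Wirr]; split; first exact: preimage_subrep.
  apply: contra_neq W0 => MW0; apply/seteqP; split=> [v Wv|v ->].
    have : (M @^-1` W) (L v) by rewrite /= LK.
    by rewrite MW0 => /(congr1 M); rewrite LK linear0.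
  exact: sW.1.1.
move=> U sU UW; have [||LU|LU] := Wirr (L @^-1` U).
- exact: preimage_inv_subrep.
- by move=> v Uv; rewrite -[v]LK; exact: UW.
- left; apply/seteqP; split=> [v Uv|v ->]; last exact: sU.1.1.
  have : (L @^-1` U) (M v) by rewrite /= MK.
  by rewrite LU => /(congr1 L); rewrite MK L0.
- right; apply/seteqP; split=> // v /=; rewrite -LU /= MK //.
Qed.

Lemma preimage_degree W m : has_degree W m -> has_degree (M @^-1` W) m.
Proof.
move=> [e We eB]; exists (L \o e) => [i|v Wv]; first by rewrite /= LK.
have ML (k : 'I_m -> K) : M (\sum_i k i *: L (e i)) = \sum_i k i *: e i.
  by rewrite linear_sum; apply: eq_bigr => i _; rewrite linearZ /= LK.
have [k [vE kU]] := eB _ Wv; exists k; split=> [|l lE].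
  by apply: (can_inj MK); rewrite ML.
by apply: kU; rewrite lE ML.
Qed.

Lemma decomposes_transport m degs :
  decomposes rho' setT m degs -> decomposes rho setT m degs.
Proof.
move=> [W [deg [[_ dW] irrW degP]]]; exists (fun j => M @^-1` W j), deg; split=> //.
  split=> // v _; have [w [[Ww vE] wU]] := dW (M v) I.
  exists (L \o w); split=> [|w' [Ww' v'E]].
    split=> [j|]; first by rewrite /= LK.
    apply: (can_inj MK); rewrite vE linear_sum; apply: eq_bigr => j _.
    by rewrite /= LK.
  apply/funext => j; rewrite /= (wU (M \o w')) /= ?MK //; split=> //.
  by rewrite v'E linear_sum.
move=> j; have [Wirr Wdeg] := irrW j.
by split; [exact: preimage_irreducible|exact: preimage_degree].
Qed.

End Transport.

(** By transitivity the cosets of the stabilizer of [p ^ n] correspond to the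
    words of length [n]. *)
Section CosetWords.
Variables (q n : nat) (S : set (treeAut q.+2)) (p : 'I_q.+2).
Hypothesis trans : forall u, exists2 g, generated S g & g (nseq (size u) p) = u.
Local Notation X := (n.-tuple 'I_q.+2).
Local Notation H := (generated_group S).
Local Notation Q := (vertex_stab (nseq n p) : set H).

Lemma left_coset_eq (g h : H) :
  (left_coset Q g = left_coset Q h) <->
  (val g (nseq n p) = val h (nseq n p) :> seq _).
Proof.
have valgM (x y : H) w : val (x * y)%g w = val x (val y w) by [].
split=> [gh|gh].
  have : left_coset Q g g by exists 1%g; rewrite ?mulg1.
  by rewrite gh => -[k /= kp <-]; rewrite valgM kp.
suff sub (x y : H) : val x (nseq n p) = val y (nseq n p) :> seq _ ->
    left_coset Q x `<=` left_coset Q y by apply/seteqP; split; exact: sub.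
move=> xy _ [k /= kp <-]; exists (y^-1 * (x * k))%g;
  last by rewrite !mulgA mulgV mul1g.
by change (val (y^-1 * (x * k))%g (nseq n p) = nseq n p);
  rewrite !valgM kp xy -valgM mulVg.
Qed.

Lemma word_repr_ex (x : X) : exists g : H, val g (nseq n p) = x :> seq _.
Proof.
have [g Sg gx] := trans x; have Hg : g \in generated S by rewrite inE.
by exists (SigSub Hg); rewrite -gx size_tuple.
Qed.

Definition word_repr (x : X) : H := sval (cid (word_repr_ex x)).

Lemma word_reprE x : val (word_repr x) (nseq n p) = x :> seq _.
Proof. by rewrite /word_repr; case: cid. Qed.

Lemma coset_of_word_subproof x : left_coset Q (word_repr x) \in coset_space Q.
Proof. by rewrite inE; exists (word_repr x). Qed.

Definition coset_of_word x : coset_space Q := SigSub (coset_of_word_subproof x).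

Lemma coset_of_word_inj : injective coset_of_word.
Proof.
move=> x y /(congr1 val) /= /left_coset_eq.
by rewrite !word_reprE => /val_inj.
Qed.

Lemma coset_of_word_surj (D : coset_space Q) : exists x, coset_of_word x = D.
Proof.
have : coset_space Q (val D) by have := valP D; rewrite inE.
case=> h _ hD; have gx : size (val h (nseq n p)) == n.
  by rewrite size_aut size_nseq.
exists (Tuple gx); apply: val_inj; rewrite /= -hD.
by apply/left_coset_eq; rewrite word_reprE.
Qed.

Definition word_of_coset D : X := sval (cid (coset_of_word_surj D)).

Lemma word_of_cosetK : cancel word_of_coset coset_of_word.
Proof. by move=> D; rewrite /word_of_coset; case: cid. Qed.

Lemma coset_of_wordK : cancel coset_of_word word_of_coset.
Proof. by move=> x; apply: coset_of_word_inj; rewrite word_of_cosetK. Qed.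

Lemma coset_act_word (g : H) x :
  coset_act g (coset_of_word x) = coset_of_word (level_act (val g) x).
Proof.
apply: val_inj => /=.
have -> : [set (g * y)%g | y in left_coset Q (word_repr x)] =
    left_coset Q (g * word_repr x)%g.
  rewrite /left_coset image_comp; apply: eq_imagel => y _ /=; rewrite mulgA //.
by apply/left_coset_eq; rewrite word_reprE /= -[in RHS]word_reprE.
Qed.

Lemma finite_coset_space : finite_set [set: coset_space Q].
Proof.
suff <- : coset_of_word @` setT = setT by apply: finite_image; exact: finite_finset.
by apply/seteqP; split=> // D _; exists (word_of_coset D); rewrite ?word_of_cosetK.
Qed.

Lemma ell2_setT (R : realType) : ell2 R Q = setT.
Proof.
apply/seteqP; split=> // f _; rewrite /ell2 /= esum_fset => [||x _].
- rewrite ltey_eq; apply/orP; left; rewrite fsbig_finite; last exact: finite_coset_space.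
  by apply/sum_fin_numP.
- exact: finite_coset_space.
- by rewrite lee_fin addr_ge0 // sqr_ge0.
Qed.

Section Restrict.
Variable R : realType.

Definition on_words (f : coset_space Q -> R[i]) : X -> R[i] :=
  f \o coset_of_word.

Lemma on_words_linear : linear on_words.
Proof. by []. Qed.

HB.instance Definition _ := GRing.isLinear.Build R[i] (coset_space Q -> R[i])
  (X -> R[i]) *:%R on_words on_words_linear.

Lemma quasi_regular_decomposes m degs :
  decomposes (level_rep (S := S)) (setT : set (X -> R[i])) m degs ->
  decomposes (quasi_regular Q) (ell2 R Q) m degs.
Proof.
rewrite ell2_setT.
apply: (@decomposes_transport _ _ _ _ _ _ on_words (fun v => v \o word_of_coset)).
- by move=> f; apply/funext => D; rewrite /= /on_words /= word_of_cosetK.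
- by move=> v; apply/funext => x; rewrite /= /on_words /= coset_of_wordK.
move=> g f; apply/funext => x.
exact: (congr1 f (coset_act_word g^-1%g x)).
Qed.

End Restrict.

End CosetWords.

(** * The five decompositions *)

Theorem ray_stab_decomposes (R : realType) q n (S : set (treeAut q.+2)) p (z : R[i]) :
    q.+2.-primitive_root z -> ray_criterion S p -> (0 < n)%N ->
  decomposes (quasi_regular (vertex_stab (nseq n p) : set (generated_group S)))
    (ell2 R (vertex_stab (nseq n p))) (q.+1 * n).+1
    (mkseq (fun k => q.+2 ^ (k.-1 %/ q.+1))%N (q.+1 * n).+1).
Proof.
move=> zP [rS sr sib] n_gt0; apply: quasi_regular_decomposes.
  exact: level_transitive.
exact: level_rep_decomposes zP rS sr sib n_gt0.
Qed.

Lemma prim_root2 (R : realType) : 2.-primitive_root (-1 : R[i]).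
Proof.
have m1 : (-1 : R[i]) != 1 by rewrite eq_sym -subr_eq0 opprK (pnatr_eq0 _ 2).
apply/andP; split=> //; apply/forallP => -[[|[|//]] i2] /=.
  by rewrite unity_rootE expr1 (negPf m1).
by rewrite unity_rootE sqrrN expr1n !eqxx.
Qed.

Lemma prim_root3 (R : realType) : exists z : R[i], 3.-primitive_root z.
Proof.
have [|z] := @solve_monicpoly R[i] 2 (fun i => -1); first by [].
rewrite big_ord_recl big_ord1 /= expr0 expr1 mulr1 mulN1r => z2; exists z.
have z3 : z ^+ 3 = 1 by rewrite exprSr z2; ring: z2.
have z1 : z != 1.
  apply: contra_eq_neq z2 => ->; rewrite expr1n -subr_eq0.
  have -> : 1 - (-1 - 1) = 3%:R :> R[i] by ring.
  by rewrite pnatr_eq0.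
apply/andP; split=> //; apply/forallP => -[[|[|[|//]]] i3] /=.
- by rewrite unity_rootE expr1 (negPf z1).
- rewrite unity_rootE; apply/eqP/negbTE; apply: contra_neq z1 => z21.
  by rewrite -z3 exprSr z21 mul1r.
- by rewrite unity_rootE z3 !eqxx.
Qed.

Lemma degrees2 n : (0 < n)%N -> mkseq (fun k => 2 ^ (k.-1 %/ 1))%N (1 * n).+1%N =
  ([:: 1; 1] ++ [seq 2 ^ i | i <- index_iota 1 n])%N.
Proof.
case: n => // n _; rewrite mul1n /mkseq /index_iota subSS subn0 /=.
congr [:: _, _ & _]; rewrite (iotaDl 1 1) -map_comp; apply: eq_map => k /=.
by rewrite divn1.
Qed.

Lemma degrees3 n : (0 < n)%N -> mkseq (fun k => 3 ^ (k.-1 %/ 2))%N (2 * n).+1%N =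
  ([:: 1; 1; 1] ++ flatten [seq [:: 3 ^ i; 3 ^ i] | i <- index_iota 1 n])%N.
Proof.
case: n => // n _; elim: n => [|n IHn]; first by [].
rewrite mulnS !addSn add0n 2!mkseqS IHn.
have -> : index_iota 1 n.+2 = rcons (index_iota 1 n.+1) n.+1.
  by rewrite /index_iota !subSS !subn0 -[n.+1 in LHS]addn1 iotaD cats1.
rewrite map_rcons flatten_rcons -!cats1 -!catA /=.
do 3!congr cons; congr (_ ++ [:: _; _]); congr (_ ^ _)%N.
  by rewrite mulKn.
by rewrite /= -addn1 mulnC divnMDl // addn0.
Qed.

Local Close Scope ring_scope.
Local Close Scope classical_set_scope.
Unset Implicit Arguments.

Theorem theorem9p7 (R : realType) (n : nat) (hn : (1 <= n)%N) :
  (let degs := ([:: 1; 1] ++ [seq 2 ^ i | i <- index_iota 1 n])%N in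
   decomposes (quasi_regular (P_G n)) (ell2 R (P_G n)) n.+1 degs /\
   decomposes (quasi_regular (P_G_tilde n)) (ell2 R (P_G_tilde n)) n.+1 degs)
  /\
  (let degs :=
     ([:: 1; 1; 1] ++ flatten [seq [:: 3 ^ i; 3 ^ i] | i <- index_iota 1 n])%N in
   [/\ decomposes (quasi_regular (P_Gamma n)) (ell2 R (P_Gamma n))
         (2 * n).+1 degs,
       decomposes (quasi_regular (P_Gamma_bar n)) (ell2 R (P_Gamma_bar n))
         (2 * n).+1 degs
     & decomposes (quasi_regular (P_Gamma_barbar n)) (ell2 R (P_Gamma_barbar n))
         (2 * n).+1 degs]).
Proof.
split=> [degs|degs].
  have n1 : n.+1 = (1 * n).+1 by rewrite mul1n.
  rewrite /degs -degrees2 // n1.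
  split; apply: (ray_stab_decomposes (prim_root2 R)) => //.
    exact: ray_criterion_G.
  exact: ray_criterion_G_tilde.
have [z zP] := prim_root3 R; rewrite /degs -degrees3 //.
split; apply: (ray_stab_decomposes zP) => //.
- exact: ray_criterion_Gamma.
- exact: ray_criterion_Gamma_bar.
- exact: ray_criterion_Gamma_barbar.
Qed.
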